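(* Let $\Phi=(\{E_i\}_{i=0}^d;\{E^*_i\}_{i=0}^d)$ be a symmetric idempotent system on $V$, and let $\dagger$ be the antiautomorphism of $\mathrm{End}(V)$ that fixes each of $E_i$, $E^*_i$ $(0\le i\le d)$. Let $\langle\,,\,\rangle$ be a bilinear form on $V$ associated with $\dagger$. Then $\langle\,,\,\rangle$ is symmetric, that is, $\langle u,v\rangle=\langle v,u\rangle$ for all $u,v\in V$.
   Context: $\mathbb{F}$ is a field, $d\ge 0$ an integer, $V$ a vector space over $\mathbb{F}$ of dimension $d+1$, $\mathrm{End}(V)$ the $\mathbb{F}$-algebra of linear maps $V\to V$. An antiautomorphism of an algebra $\mathcal{A}$ is an $\mathbb{F}$-linear bijection $\tau:\mathcal{A}\to\mathcal{A}$ with $(YZ)^\tau=Z^\tau Y^\tau$. Idempotent system on $V$: a sequence $\Phi=(\{E_i\}_{i=0}^d;\{E^*_i\}_{i=0}^d)$ of elements of $\mathrm{End}(V)$ such that $E_iE_j=\delta_{i,j}E_i$, $\mathrm{rank}(E_i)=1$, $E^*_iE^*_j=\delta_{i,j}E^*_i$, $\mathrm{rank}(E^*_i)=1$, $E_0E^*_iE_0\neq 0$, $E^*_0E_iE^*_0\ne 0$ for $0\le i,j\le d$. It is symmetric if there is an antiautomorphism $\dagger$ of $\mathrm{End}(V)$ fixing each $E_i$ and each $E^*_i$; such $\dagger$ is unique. For an antiautomorphism $\gamma$ of $\mathrm{End}(V)$, a bilinear form on $V$ associated with $\gamma$ is a nonzero bilinear form $\langle\,,\,\rangle:V\times V\to\mathbb{F}$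 with $\langle Au,v\rangle=\langle u,A^\gamma v\rangle$ for all $u,v\in V$, $A\in\mathrm{End}(V)$. Such a form exists, is nondegenerate, and is unique up to multiplication by a nonzero scalar. *)

(* Defs.v *)
From HB Require Import structures.
From mathcomp Require Import all_boot all_algebra.
Set Implicit Arguments.
Unset Strict Implicit.
Unset Printing Implicit Defensive.
Import GRing.Theory.
Local Open Scope ring_scope.

(* The product of End(V) is composition, (A \o B) u = A (B u), written          *)
(* explicitly: for a general V : vectType F, 'End(V) carries no canonical ring  *)
(* structure, and the one falgebra puts on 'End(V) is the reversed composition. *)

Definition lfun_rank (F : fieldType) (V : vectType F) (A : 'End(V)) : nat :=
  \dim (limg A).

Record antiautomorphism (F : fieldType) (V : vectType F)
    (tau : 'End(V) -> 'End(V)) : Prop := {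
  antiaut_linear : linear tau;
  antiaut_bij : bijective tau;
  antiaut_comp : forall Y Z : 'End(V), tau (Y \o Z)%VF = (tau Z \o tau Y)%VF
}.

Record idempotent_system (F : fieldType) (d : nat) (V : vectType F)
    (E Es : 'I_d.+1 -> 'End(V)) : Prop := {
  is_idem : forall i j, (E i \o E j)%VF = (i == j)%:R *: E i;
  is_rank : forall i, lfun_rank (E i) = 1%N;
  is_idem_dual : forall i j, (Es i \o Es j)%VF = (i == j)%:R *: Es i;
  is_rank_dual : forall i, lfun_rank (Es i) = 1%N;
  is_neq0 : forall i, (E ord0 \o Es i \o E ord0)%VF != 0;
  is_neq0_dual : forall i, (Es ord0 \o E i \o Es ord0)%VF != 0
}.

Definition fixes_system (F : fieldType) (d : nat) (V : vectType F)
    (E Es : 'I_d.+1 -> 'End(V)) (tau : 'End(V) -> 'End(V)) : Prop :=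
  forall i, tau (E i) = E i /\ tau (Es i) = Es i.

Definition symmetric_idempotent_system (F : fieldType) (d : nat)
    (V : vectType F) (E Es : 'I_d.+1 -> 'End(V)) : Prop :=
  idempotent_system E Es /\
  exists tau : 'End(V) -> 'End(V), antiautomorphism tau /\ fixes_system E Es tau.

Definition associated_form (F : fieldType) (V : vectType F)
    (gamma : 'End(V) -> 'End(V)) (form : {biscalar V}) : Prop :=
  (exists u v : V, form u v != 0) /\
  forall (A : 'End(V)) (u v : V), form (A u) v = form u (gamma A v).

(* Main.v *)
Require Import Defs.
From HB Require Import structures.
From mathcomp Require Import all_boot all_algebra.
Set Implicit Arguments.
Unset Strict Implicit.
Unset Printing Implicit Defensive.
Import GRing.Theory.
Local Open Scope ring_scope.

(** Nonzero vectors chosen in the images of the E_i form an orthogonal basis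
    of V, and a bilinear form whose Gram matrix in some basis is diagonal is
    symmetric ([orthogonal_basis_symmetric]).

    If e_i != 0 is in the image of E_i, then E_i e_j = [i = j] e_j because the
    E_i are mutually orthogonal idempotents. Eigenvectors separated in this way
    are free ([idempotent_eigenvectors_free]), and there are dim V of them, so
    they are a basis. Since the antiautomorphism fixes E_i, each E_i is
    self-adjoint for the form, and for i != j
      <e_i, e_j> = <E_i e_i, e_j> = <e_i, E_i e_j> = 0. *)

Section OrthogonalBasis.

Variables (F : fieldType) (V : vectType F) (n : nat).

(** Applying [P i] to a relation [\sum_j k j *: e`_j = 0] leaves
    [k i *: e`_i = 0]. *)
Lemma idempotent_eigenvectors_free (P : 'I_n -> 'End(V)) (e : n.-tuple V) :
    (forall i : 'I_n, e`_i != 0) ->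
    (forall i j : 'I_n, P i e`_j = (i == j)%:R *: e`_j) ->
  free e.
Proof.
move=> e_neq0 Pe; apply/freeP => k sum0 i.
have /eqP := congr1 (P i) sum0.
rewrite linear0 linear_sum (bigD1 i) //= big1 => [|j ne_ji].
  rewrite linearZ /= Pe eqxx scale1r addr0 scaler_eq0 (negPf (e_neq0 i)) orbF.
  by move/eqP.
by rewrite linearZ /= Pe eq_sym (negPf ne_ji) scale0r scaler0.
Qed.

(** Only the diagonal terms survive in the expansion over [e], so
    [form u v] is the sum of the [u_i * v_i * form e`_i e`_i], in which [u] and
    [v] can be exchanged because scalars commute. *)
Lemma orthogonal_basis_symmetric (form : {biscalar V}) (e : n.-tuple V) :
    basis_of fullv e ->
    (forall i j : 'I_n, i != j -> form e`_i e`_j = 0) ->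
  forall u v, form u v = form v u.
Proof.
move=> basis_e ortho.
have diag u v :
    form u v = \sum_i coord e i u * coord e i v * form e`_i e`_i.
  rewrite {1}(coord_basis basis_e (memvf u)) linear_sumlz.
  apply: eq_bigr => i _; rewrite linearZl_LR /=.
  rewrite {1}(coord_basis basis_e (memvf v)) linear_sumr (bigD1 i) //=.
  rewrite big1 => [|j ne_ji]; first by rewrite linearZr_LR /= addr0 mulrA.
  by rewrite linearZr_LR /= ortho ?mulr0 // eq_sym.
by move=> u v; rewrite !diag; apply: eq_bigr => i _; rewrite [X in X * _]mulrC.
Qed.

End OrthogonalBasis.

Theorem lemma17p3 (F : fieldType) (d : nat) (V : vectType F)
    (dimV : \dim {:V} = d.+1)
    (E Es : 'I_d.+1 -> 'End(V))
    (symPhi : symmetric_idempotent_system E Es)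
    (dagger : 'End(V) -> 'End(V))
    (dagger_anti : antiautomorphism dagger)
    (dagger_fix : fixes_system E Es dagger)
    (form : {biscalar V})
    (form_dagger : associated_form dagger form) :
  forall u v : V, form u v = form v u.
Proof.
have [[idemE rankE _ _ _ _] _] := symPhi.
have [_ adjoint] := form_dagger.
pose e := [tuple vpick (limg (E i)) | i < d.+1].
have eE (i : 'I_d.+1) : e`_i = vpick (limg (E i)).
  by rewrite -tnth_nth tnth_mktuple.
have e_neq0 (i : 'I_d.+1) : e`_i != 0.
  rewrite eE vpick0; apply/eqP => img0.
  by have := rankE i; rewrite /lfun_rank img0 dimv0.
have Ee (i j : 'I_d.+1) : E i e`_j = (i == j)%:R *: e`_j.
  rewrite eE; have /memv_imgP [x _ ->] := memv_pick (limg (E j)).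
  rewrite -comp_lfunE idemE scale_lfunE.
  by case: eqP => [-> | _]; rewrite ?scale0r.
have basis_e : basis_of fullv e.
  rewrite basisEfree (idempotent_eigenvectors_free e_neq0 Ee) subvf.
  by rewrite size_tuple dimV leqnn.
apply: (orthogonal_basis_symmetric basis_e) => i j ne_ij.
have <- : E i e`_i = e`_i by rewrite Ee eqxx scale1r.
by rewrite adjoint (dagger_fix i).1 Ee (negPf ne_ij) scale0r linear0r.
Qed.
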